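(* Let $M$ be a map drawn in the plane and let $G = U(M)$ be its underlying graph. There does not exist a subgraph $H$ of $G$, with $h$ vertices, such that $H$ is a complete planar graph and $h > 4$.
   Context: Graphs are finite. A map $M$ drawn in the plane is a drawing of a graph in the plane without edge crossings; the graph $U(M)$ of its vertices and edges is called the underlying graph of $M$. A planar graph is a graph which can be drawn in the plane so that its edges do not cross. A complete graph is a graph in which every vertex is connected by an edge to every other vertex. *)

(* Defs.v *)
From HB Require Import structures.
From mathcomp Require Import all_boot all_order all_algebra.
From mathcomp Require Import all_classical all_reals all_analysis.

Set Implicit Arguments.
Unset Strict Implicit.
Unset Printing Implicit Defensive.

Import Order.TTheory GRing.Theory Num.Theory.
Import numFieldNormedType.Exports.

Local Open Scope classical_set_scope.
Local Open Scope ring_scope.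

(* Loops and parallel edges are allowed. Edges are undirected: which end is   *)
(* called source is an arbitrary choice, and adjacency is insensitive to it.  *)
Record graph := Graph {
  vertex : finType;
  edge : finType;
  src : edge -> vertex;
  tgt : edge -> vertex }.

Definition joins (G : graph) (e : edge G) (u v : vertex G) : Prop :=
  (src e = u /\ tgt e = v) \/ (src e = v /\ tgt e = u).

Definition complete (G : graph) : Prop :=
  forall u v : vertex G, u != v -> exists e : edge G, joins e u v.

Record subgraph (G : graph) := Subgraph {
  sub_vertices : {set vertex G};
  sub_edges : {set edge G};
  sub_src : forall e, e \in sub_edges -> src e \in sub_vertices;
  sub_tgt : forall e, e \in sub_edges -> tgt e \in sub_vertices }.

Definition graph_of_subgraph (G : graph) (H : subgraph G) : graph :=
  @Graph {v : vertex G | v \in sub_vertices H}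
         {e : edge G | e \in sub_edges H}
         (fun e => exist _ (src (val e)) (sub_src (valP e)))
         (fun e => exist _ (tgt (val e)) (sub_tgt (valP e))).

Coercion graph_of_subgraph : subgraph >-> graph.

(* [curve e] is only relevant on [0, 1]. Injectivity is required on ]0, 1[    *)
(* so that a loop is a simple closed curve; for an edge with distinct ends    *)
(* the other conditions make [curve e] injective on the whole of [0, 1].      *)
Record is_drawing (R : realType) (G : graph)
    (pos : vertex G -> R * R) (curve : edge G -> R -> R * R) : Prop := {
  drawing_pos_inj : injective pos;
  drawing_continuous : forall e, {within `[0, 1], continuous (curve e)};
  drawing_src : forall e, curve e 0 = pos (src e);
  drawing_tgt : forall e, curve e 1 = pos (tgt e);
  drawing_simple : forall e, {in `]0, 1[ &, injective (curve e)};
  drawing_avoids : forall e (t : R) v, t \in `]0, 1[ -> curve e t != pos v;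
  drawing_no_crossing : forall e f (s t : R), e != f ->
    s \in `]0, 1[ -> t \in `]0, 1[ -> curve e s != curve f t }.

Definition planar (R : realType) (G : graph) : Prop :=
  exists (pos : vertex G -> R * R) (curve : edge G -> R -> R * R),
    is_drawing pos curve.

Record plane_map (R : realType) := PlaneMap {
  underlying_graph : graph;
  map_pos : vertex underlying_graph -> R * R;
  map_curve : edge underlying_graph -> R -> R * R;
  map_drawing : is_drawing map_pos map_curve }.

(* Main.v *)
(* Cut every edge into n+1 small pieces and, for an edge e and a vertex v, let
   a(e, v) be the parity of the number of pieces of e hit by the upward
   vertical ray from v. For two edges e = uv and f = xy without common end, the
   arcs are disjoint compact sets, so for n large any piece of e is separated
   from any piece of f by a horizontal or vertical line; summing over all pairs
   of pieces and telescoping gives, modulo 2,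
     a(e, x) + a(e, y) + a(f, u) + a(f, v) = 1 iff the abscissae of u, v
   interleave with those of x, y.
   In K5, sum this over the 15 pairs of edges without common end. On the left
   each a(e, v) occurs twice, for the two edges at v disjoint from e; on the
   right each of the five quadruples of vertices splits into interleaving pairs
   in exactly one way. Hence 0 = 5 modulo 2. *)
From mathcomp Require Import all_boot all_order all_algebra.
From mathcomp Require Import all_classical all_reals all_analysis.
From mathcomp Require Import zify lra.
Require Import Defs.

Set Implicit Arguments.
Unset Strict Implicit.
Unset Printing Implicit Defensive.

Import Order.TTheory GRing.Theory Num.Theory.
Import numFieldNormedType.Exports.

Local Open Scope ring_scope.

(** * Parity identity for separated pieces and polygonal paths *)

Section Staircase.
Variable R : realType.
Implicit Types p q r s : R * R.

(* Comparing abscissae lexicographically makes all vertices comparable, which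
   spares putting the drawing in general position. *)
Definition lex_lt p q := (p.1 < q.1) || ((p.1 == q.1) && (p.2 < q.2)).

Lemma lex_ltN p q : p != q -> lex_lt q p = ~~ lex_lt p q.
Proof.
rewrite /lex_lt -pair_eqE /=.
by case: (ltgtP p.1 q.1) => //= _; case: (ltgtP p.2 q.2).
Qed.

Definition straddle p q r := lex_lt p r (+) lex_lt q r.

Lemma straddleC p q r : straddle p q r = straddle q p r.
Proof. exact: addbC. Qed.

(* The piece from p to q is replaced by a horizontal step at the height of p:
   for separated pieces only the parities of [below_separated] matter. *)
Definition below p q r := straddle p q r && (r.2 < p.2).

(** Strict inequalities make separation of two points persist for all points close to them. *)
Definition separated p q r s := exists m : R,
  [\/ [/\ p.1 < m, q.1 < m, m < r.1 & m < s.1],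
      [/\ m < p.1, m < q.1, r.1 < m & s.1 < m],
      [/\ p.2 < m, q.2 < m, m < r.2 & m < s.2] |
      [/\ m < p.2, m < q.2, r.2 < m & s.2 < m]].

Lemma lt_lex_lt m p q : p.1 < m -> m < q.1 -> lex_lt p q.
Proof. by move=> pm mq; rewrite /lex_lt (lt_trans pm mq). Qed.

Lemma lt_lex_ltF m p q : p.1 < m -> m < q.1 -> lex_lt q p = false.
Proof.
by move=> pm mq; rewrite /lex_lt; case: (ltgtP q.1 p.1) (lt_trans pm mq).
Qed.

(** A vertical separating line makes every [straddle] vanish. A horizontal one keeps only the
    [below] terms of the lower pair; if this is r, s, then reversing the four lexicographic
    comparisons gives the right-hand side, as the four negations cancel. *)
Lemma below_separated p q r s : separated p q r s ->
  below p q r (+) below p q s (+) (below r s p (+) below r s q)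
  = straddle r s p (+) straddle r s q.
Proof.
case=> m [] [pm qm rm sm].
- rewrite /below /straddle !(lt_lex_lt pm, lt_lex_lt qm) //.
  by rewrite !(lt_lex_ltF pm rm, lt_lex_ltF pm sm, lt_lex_ltF qm rm,
               lt_lex_ltF qm sm).
- rewrite /below /straddle !(lt_lex_lt rm, lt_lex_lt sm) //.
  by rewrite !(lt_lex_ltF rm pm, lt_lex_ltF rm qm, lt_lex_ltF sm pm,
               lt_lex_ltF sm qm).
- rewrite /below (lt_trans pm rm) (lt_trans qm rm).
  rewrite (lt_gtF (lt_trans pm rm)) (lt_gtF (lt_trans pm sm)).
  by rewrite !andbF !andbT.
- rewrite /below (lt_trans rm pm) (lt_trans sm pm).
  rewrite (lt_gtF (lt_trans rm pm)) (lt_gtF (lt_trans rm qm)) !andbF !andbT.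
  have neq (a b : R * R) : m < a.2 -> b.2 < m -> a != b.
    by move=> ma; apply: contraTneq => <-; rewrite ltNge ltW.
  rewrite /straddle !(@lex_ltN p) ?neq // !(@lex_ltN q) ?neq //.
  by case: (lex_lt p r); case: (lex_lt p s); case: (lex_lt q r);
     case: (lex_lt q s).
Qed.

Lemma addb_telescope (g : nat -> bool) n :
  \big[addb/false]_(i < n) (g i (+) g i.+1) = g 0%N (+) g n.
Proof.
elim: n => [|n IH]; first by rewrite big_ord0 addbb.
by rewrite big_ord_recr IH /= addbA addbK.
Qed.

Definition path_below (p : nat -> R * R) n r :=
  \big[addb/false]_(i < n) below (p i) (p i.+1) r.

Lemma path_below_separated (p q : nat -> R * R) m n :
    (forall i j, (i < m)%N -> (j < n)%N ->
       separated (p i) (p i.+1) (q j) (q j.+1)) ->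
  path_below p m (q 0%N) (+) path_below p m (q n)
    (+) (path_below q n (p 0%N) (+) path_below q n (p m))
  = straddle (q 0%N) (q n) (p 0%N) (+) straddle (q 0%N) (q n) (p m).
Proof.
move=> sep.
(* End point terms become telescoping sums, first along p, then along q, so that the identity can be
   checked on each pair of pieces. *)
rewrite -(addb_telescope (fun i => path_below q n (p i))).
rewrite -(addb_telescope (fun i => straddle (q 0%N) (q n) (p i))).
rewrite -!big_split /=; apply: eq_bigr => i _.
rewrite -(addb_telescope (fun j => below (p i) (p i.+1) (q j))) -!big_split /=.
under eq_bigr => j _.
  rewrite (below_separated (sep i j (ltn_ord i) (ltn_ord j))); over.
rewrite big_split /=; congr addb.
  exact: (addb_telescope (fun j => lex_lt (q j) (p i))).
exact: (addb_telescope (fun j => lex_lt (q j) (p i.+1))).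
Qed.

End Staircase.

(** * Uniform separation of disjoint arcs after fine sampling *)

Section Sampling.
Variable R : realType.
Local Open Scope classical_set_scope.

Definition sample (c : R -> R * R) n i := c (i%:R * n.+1%:R^-1).

Lemma sample0 c n : sample c n 0 = c 0.
Proof. by rewrite /sample mul0r. Qed.

Lemma sample_last c n : sample c n n.+1 = c 1.
Proof. by rewrite /sample mulfV. Qed.

Lemma near_step (c : R -> R * R) (s : R) (U : set (R * R)) :
    {within `[0, 1], continuous c} -> s \in `[0, 1]%R -> nbhs (c s) U ->
  \forall x \near s & n \near \oo,
    (x \in `[0, 1]%R -> U (c x)) /\
    (x + n.+1%:R^-1 \in `[0, 1]%R -> U (c (x + n.+1%:R^-1))).
Proof.
move=> /subspace_continuousP c_cont s01 cU.
have /nbhs_ballP[r /= r0 rU] : nbhs s (fun x => x \in `[0, 1]%R -> U (c x)).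
  have := c_cont s s01 U cU.
  by rewrite nbhs_filterE /= /within /=; exact.
(* Half of r covers the distance from s to x, the other half the step. *)
have r20 : 0 < r / 2 by rewrite divr_gt0.
near=> x n.
have sx : `|s - x| < r / 2.
  by near: x; apply/nbhs_ballP; exists (r / 2).
have step : n.+1%:R^-1 < r / 2 :> R.
  by near: n; exact: (near_infty_natSinv_lt (PosNum r20)).
have step0 : 0 < n.+1%:R^-1 :> R by rewrite invr_gt0.
split=> x01; apply: rU => //=; rewrite /ball /=; first lra.
rewrite opprD addrA; apply: (le_lt_trans (ler_normB _ _)).
by rewrite (gtr0_norm step0) [ltRHS]splitr ltrD.
Unshelve. all: by end_near. Qed.

Lemma separate_points (p q : R * R) : p != q -> separated p p q q.
Proof.
rewrite -pair_eqE /= negb_and /separated.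
have mid (a b : R) : a != b ->
    exists m, (a < m /\ m < b) \/ (m < a /\ b < m).
  move=> ab; exists ((a + b) / 2).
  by case: (ltgtP a b) ab => // ab _; [left|right]; lra.
by case/orP=> /mid[m [[? ?]|[? ?]]]; exists m;
  [constructor 1|constructor 2|constructor 3|constructor 4].
Qed.

(** Separation is clear locally, around each pair of parameters; compactness of the unit square, in
    its near-covering form, yields one n for all pairs. *)
Lemma near_separated (c d : R -> R * R) :
    {within `[0, 1], continuous c} -> {within `[0, 1], continuous d} ->
    (forall s t, s \in `[0, 1]%R -> t \in `[0, 1]%R -> c s != d t) ->
  \forall n \near \oo, forall i j, (i < n.+1)%N -> (j < n.+1)%N ->
    separated (sample c n i) (sample c n i.+1) (sample d n j) (sample d n j.+1).
Proof.
move=> c_cont d_cont cd.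
have K : compact (`[0, 1] `*` `[0, 1] : set (R * R)).
  by apply: compact_setX; exact: segment_compact.
have cover : near_covering (`[0, 1] `*` `[0, 1] : set (R * R)).
  exact/compact_near_coveringP.
(* Parameters near a point of the square, or their successors, may leave it; hence the guards. *)
pose P n (x : R * R) :=
  x.1 + n.+1%:R^-1 \in `[0, 1]%R -> x.2 + n.+1%:R^-1 \in `[0, 1]%R ->
  x.1 \in `[0, 1]%R -> x.2 \in `[0, 1]%R ->
  separated (c x.1) (c (x.1 + n.+1%:R^-1)) (d x.2) (d (x.2 + n.+1%:R^-1)).
have nearP : \forall n \near \oo, `[0, 1] `*` `[0, 1] `<=` P n.
  apply: (cover nat \oo P) => [[s t]] /= [s01 t01].
  have [m sep] := separate_points (cd s t s01 t01).
  have near_sep (U V : set (R * R)) : nbhs (c s) U -> nbhs (d t) V ->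
      (forall p q r s', U p -> U q -> V r -> V s' -> separated p q r s') ->
    \forall x \near (s, t) & n \near \oo, P n x.
    move=> /(near_step c_cont s01)[[A1 A2] /= [nA1 nA2] cU].
    move=> /(near_step d_cont t01)[[B1 B2] /= [nB1 nB2] dV] sepUV.
    near=> x n => cx1 dx1 cx dx.
    have [Ucx Ucx1] : (x.1 \in `[0, 1]%R -> U (c x.1)) /\
        (x.1 + n.+1%:R^-1 \in `[0, 1]%R -> U (c (x.1 + n.+1%:R^-1))).
      apply: (cU (x.1, n)); split=> /=; last by near: n.
      by near: x; exact: (@cvg_fst _ _ _ (nbhs t)).
    have [Vdx Vdx1] : (x.2 \in `[0, 1]%R -> V (d x.2)) /\
        (x.2 + n.+1%:R^-1 \in `[0, 1]%R -> V (d (x.2 + n.+1%:R^-1))).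
      apply: (dV (x.2, n)); split=> /=; last by near: n.
      by near: x; exact: (@cvg_snd _ _ (nbhs s)).
    by apply: sepUV; [exact: Ucx|exact: Ucx1|exact: Vdx|exact: Vdx1].
  have lt1 (p : R * R) : p.1 < m -> nbhs p (fun q => q.1 < m).
    by move=> pm; apply: (cvgr_lt _ (@cvg_fst _ _ _ _ _)).
  have gt1 (p : R * R) : m < p.1 -> nbhs p (fun q => m < q.1).
    by move=> pm; apply: (cvgr_gt _ (@cvg_fst _ _ _ _ _)).
  have lt2 (p : R * R) : p.2 < m -> nbhs p (fun q => q.2 < m).
    by move=> pm; apply: (cvgr_lt _ (@cvg_snd _ _ _ _ _)).
  have gt2 (p : R * R) : m < p.2 -> nbhs p (fun q => m < q.2).
    by move=> pm; apply: (cvgr_gt _ (@cvg_snd _ _ _ _ _)).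
  case: sep => [] [cm _ dm _].
  - apply: (near_sep _ _ (lt1 _ cm) (gt1 _ dm)) => *.
    by exists m; constructor 1.
  - apply: (near_sep _ _ (gt1 _ cm) (lt1 _ dm)) => *.
    by exists m; constructor 2.
  - apply: (near_sep _ _ (lt2 _ cm) (gt2 _ dm)) => *.
    by exists m; constructor 3.
  - apply: (near_sep _ _ (gt2 _ cm) (lt2 _ dm)) => *.
    by exists m; constructor 4.
near=> n => i j i_n j_n.
have itv k : (k <= n.+1)%N -> k%:R * n.+1%:R^-1 \in `[0, 1 : R]%R.
  move=> kn; rewrite in_itv /= divr_ge0 //=.
  by rewrite ler_pdivrMr // mul1r ler_nat.
have stepE k : k.+1%:R * n.+1%:R^-1 = k%:R * n.+1%:R^-1 + n.+1%:R^-1 :> R.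
  by rewrite -natr1 mulrDl mul1r.
rewrite /sample !stepE.
have nP : `[0, 1] `*` `[0, 1] `<=` P n by near: n.
apply: (nP (i%:R * n.+1%:R^-1, j%:R * n.+1%:R^-1)) => /=;
  by rewrite -?stepE ?itv // ltnW.
Unshelve. all: by end_near. Qed.

End Sampling.

(** * Parity count in the complete graph on five vertices *)

Lemma addb_eq_even (a b c d k l m n : bool) :
    a (+) b (+) (c (+) d) = k (+) l (+) (m (+) n) ->
  exists z, (a + b + (c + d) + (k + l + (m + n)) = z.*2)%N.
Proof.
move=> eq_add; have := odd_double_half (a + b + (c + d) + (k + l + (m + n)))%N.
by rewrite !oddD !oddb eq_add addbb add0n => <-; eexists.
Qed.

(** Congruences modulo 2 are written as equations with a double, which makes the contradiction one
    of linear integer arithmetic. *)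
Lemma no_K5_parity_nat (A : nat -> nat -> nat -> nat) (L : nat -> nat -> nat) :
    (forall i j, (i < j < 5)%N -> (L j i + L i j = 1)%N) ->
    (forall i j k l, (i < j < 5)%N -> (k < l < 5)%N -> uniq [:: i; j; k; l] ->
      exists z, (A i j k + A i j l + (A k l i + A k l j)
        + (L k i + L l i + (L k j + L l j)) = z.*2)%N) ->
  False.
Proof.
move=> lt1 even.
(* Each quadruple is split in three ways. The three sums of L terms add up to an even number plus
   [L j i + L i j] for the three pairs among its last three vertices, so to an odd number. *)
have [z1 e1] := even 0 1 2 3 isT isT isT.
have [z2 e2] := even 0 2 1 3 isT isT isT.
have [z3 e3] := even 0 3 1 2 isT isT isT.
have [z4 e4] := even 0 1 2 4 isT isT isT.
have [z5 e5] := even 0 2 1 4 isT isT isT.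
have [z6 e6] := even 0 4 1 2 isT isT isT.
have [z7 e7] := even 0 1 3 4 isT isT isT.
have [z8 e8] := even 0 3 1 4 isT isT isT.
have [z9 e9] := even 0 4 1 3 isT isT isT.
have [z10 e10] := even 0 2 3 4 isT isT isT.
have [z11 e11] := even 0 3 2 4 isT isT isT.
have [z12 e12] := even 0 4 2 3 isT isT isT.
have [z13 e13] := even 1 2 3 4 isT isT isT.
have [z14 e14] := even 1 3 2 4 isT isT isT.
have [z15 e15] := even 1 4 2 3 isT isT isT.
have l01 := lt1 0 1 isT; have l02 := lt1 0 2 isT; have l03 := lt1 0 3 isT.
have l04 := lt1 0 4 isT; have l12 := lt1 1 2 isT; have l13 := lt1 1 3 isT.
have l14 := lt1 1 4 isT; have l23 := lt1 2 3 isT; have l24 := lt1 2 4 isT.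
have l34 := lt1 3 4 isT.
clear lt1 even.
lia.
Qed.

Lemma no_K5_parity (a : nat -> nat -> nat -> bool) (lt : rel nat) :
    (forall i j, (i < j < 5)%N -> lt j i = ~~ lt i j) ->
    (forall i j k l, (i < j < 5)%N -> (k < l < 5)%N -> uniq [:: i; j; k; l] ->
      a i j k (+) a i j l (+) (a k l i (+) a k l j)
      = lt k i (+) lt l i (+) (lt k j (+) lt l j)) ->
  False.
Proof.
move=> ltN relation.
have lt1 i j : (i < j < 5)%N -> (lt j i + lt i j = 1)%N.
  by move=> /ltN->; case: (lt i j).
apply: (no_K5_parity_nat lt1) => i j k l ij kl u.
exact: (addb_eq_even (relation i j k l ij kl u)).
Qed.

(** * Application to drawings of complete graphs *)

Section Drawing.
Variables (R : realType) (G : graph).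
Variables (pos : vertex G -> R * R) (curve : edge G -> R -> R * R).
Hypothesis D : is_drawing pos curve.

Definition independent (e f : edge G) :=
  [&& src e != src f, src e != tgt f, tgt e != src f & tgt e != tgt f].

Lemma independent_disjoint e f (s t : R) : independent e f ->
  s \in `[0, 1] -> t \in `[0, 1] -> curve e s != curve f t.
Proof.
case/and4P=> ss st ts tt.
have ef : e != f by apply: contraNneq ss => ->.
have itv (x : R) : x \in `[0, 1] -> [\/ x = 0, x = 1 | x \in `]0, 1[].
  rewrite !in_itv /=; case: (ltgtP 0 x) => //= [x0|<-]; last by constructor 1.
  by case: (ltgtP x 1) => // [x1|->] _; [constructor 3|constructor 2].
have pos_neq := inj_eq (drawing_pos_inj D).
case/itv=> [->|->|s01]; case/itv=> [->|->|t01];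
  rewrite ?(drawing_src D) ?(drawing_tgt D) ?pos_neq //;
  try exact: (drawing_avoids D);
  try by rewrite eq_sym; exact: (drawing_avoids D).
exact: (drawing_no_crossing D).
Qed.

Definition edge_below n e v := path_below (sample (curve e) n) n.+1 (pos v).

Definition edge_relation n e f u v x y :=
  edge_below n e x (+) edge_below n e y
    (+) (edge_below n f u (+) edge_below n f v)
  = straddle (pos x) (pos y) (pos u) (+) straddle (pos x) (pos y) (pos v).

(** There are finitely many pairs of edges, so one n serves them all. *)
Lemma near_edge_relation :
  (\forall n \near \oo, forall e f, independent e f ->
    edge_relation n e f (src e) (tgt e) (src f) (tgt f))%classic.
Proof.
apply: filter_forall => e; apply: filter_forall => f.
have [ef|ef] := boolP (independent e f); last by near=> n.
have := near_separated (drawing_continuous D (e := e))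
  (drawing_continuous D (e := f)) (fun s t => independent_disjoint ef).
apply: filterS => n /path_below_separated.
by rewrite !sample0 !sample_last !(drawing_src D) !(drawing_tgt D).
Unshelve. all: by end_near. Qed.

(** The relation is invariant under exchanging the ends of either edge, so the arbitrary orientation
    is harmless. *)
Lemma edge_relation_joins n e f u v x y : joins e u v -> joins f x y ->
    edge_relation n e f (src e) (tgt e) (src f) (tgt f) ->
  edge_relation n e f u v x y.
Proof.
rewrite /edge_relation => -[[<- <-]|[<- <-]] [[<- <-]|[<- <-]] //.
- rewrite !(straddleC (pos (tgt f))) => <-.
  by rewrite [edge_below n e (tgt f) (+) _]addbC.
- by rewrite [edge_below n f (tgt e) (+) _]addbC => ->; rewrite addbC.
- rewrite [edge_below n f (tgt e) (+) _]addbC !(straddleC (pos (tgt f))).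
  by rewrite [edge_below n e (tgt f) (+) _]addbC => ->; rewrite addbC.
Qed.

Lemma complete_drawing_card : complete G -> (#|vertex G| <= 4)%N.
Proof.
move=> Gc; rewrite leqNgt; apply/negP => V5.
have [s s_uniq s5] : exists2 s : seq (vertex G), uniq s & size s = 5%N.
  exists (take 5 (enum (vertex G))); first exact/take_uniq/enum_uniq.
  by rewrite size_takel // -cardE.
have [v0 _] : exists v0, v0 \in s.
  by case: s s5 {s_uniq} => // v0 s _; exists v0; rewrite mem_head.
pose v := nth v0 s.
have v_neq i j : (i < 5)%N -> (j < 5)%N -> (v i == v j) = (i == j).
  by move=> i5 j5; rewrite nth_uniq ?s5.
(* [e0] is the default value of [E] on pairs of equal vertices. *)
have [e0 _] : exists e, joins e (v 0%N) (v 1%N) by apply: Gc; rewrite v_neq.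
have /choice[E joinsE] : forall w : vertex G * vertex G,
    exists e, w.1 != w.2 -> joins e w.1 w.2.
  move=> [u w]; have [->|uw] := eqVneq u w; first by exists e0 => /eqP.
  by have [e ?] := Gc u w uw; exists e.
have [n relation] := filter_ex near_edge_relation.
(* [E (u, w)] and [E (w, u)] may differ; the restriction to i < j fixes one edge for each pair of
   vertices. *)
apply: (@no_K5_parity (fun i j k => edge_below n (E (v i, v j)) (v k))
  (fun i j => lex_lt (pos (v i)) (pos (v j)))).
  move=> i j /andP[ij j5]; apply: lex_ltN.
  by rewrite (inj_eq (drawing_pos_inj D)) v_neq ?(ltn_trans ij) // (ltn_eqF ij).
move=> i j k l /andP[ij j5] /andP[kl l5] u4.
have [i5 k5] := (ltn_trans ij j5, ltn_trans kl l5).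
have Ee : joins (E (v i, v j)) (v i) (v j).
  by apply: (joinsE (v i, v j)); rewrite /= v_neq // (ltn_eqF ij).
have Ef : joins (E (v k, v l)) (v k) (v l).
  by apply: (joinsE (v k, v l)); rewrite /= v_neq // (ltn_eqF kl).
apply: (edge_relation_joins Ee Ef); apply: relation.
rewrite /independent.
move: u4; rewrite /= !inE !negb_or => /and4P[/and3P[_ ik il] /andP[jk jl] _ _].
case: Ee => [[-> ->]|[-> ->]]; case: Ef => [[-> ->]|[-> ->]];
  by rewrite !v_neq // ik il jk jl.
Qed.

End Drawing.

Theorem theoremC3 (R : realType) (M : plane_map R) (G : graph)
    (hG : G = underlying_graph M) :
  ~ exists (H : subgraph G) (h : nat),
      [/\ #|vertex H| = h, complete H, planar R H & (4 < h)%N].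
Proof.
case=> H [h [<- Hc [pos [curve D]]]].
by rewrite ltnNge (complete_drawing_card D Hc).
Qed.
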